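(* Let $L$ be a finite-dimensional solvable Lie algebra over an algebraically closed field $F$. Then $L$ is minimal non-elementary if and only if there exist $\alpha \in F$ and a basis $x, y, z$ of $L$ such that $[x,y] = \alpha y + z$, $[x,z] = \alpha z$ and $[y,z] = 0$.
   Context: For a finite-dimensional Lie algebra $S$, the Frattini subalgebra is the intersection of the maximal (proper) subalgebras of $S$, and the Frattini ideal $\phi(S)$ is the largest ideal of $S$ contained in the Frattini subalgebra (with $\phi(0)=0$). A Lie algebra $L$ is called elementary if $\phi(S) = 0$ for every subalgebra $S$ of $L$ (including $S = L$). A Lie algebra $L$ is called minimal non-elementary if every proper subalgebra of $L$ is elementary but $L$ itself is not elementary. *)

(* Defs.v *)
From HB Require Import structures.
From mathcomp Require Import all_boot all_order all_algebra.
From Stdlib Require Import Classical.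

Set Implicit Arguments.
Unset Strict Implicit.
Unset Printing Implicit Defensive.

Import GRing.Theory.
Local Open Scope ring_scope.

(* Finite dimension is part of the parent structure [Vector]. *)
HB.mixin Record isLieAlgebra (F : fieldType) L of Vector F L := {
  lie : L -> L -> L;
  lie_linearl : forall (a : F) (u v w : L),
    lie (a *: u + v) w = a *: lie u w + lie v w;
  lie_linearr : forall (a : F) (u v w : L),
    lie w (a *: u + v) = a *: lie w u + lie w v;
  lie_alternating : forall u : L, lie u u = 0;
  lie_jacobi : forall u v w : L,
    lie u (lie v w) + lie v (lie w u) + lie w (lie u v) = 0
}.

#[short(type="lieAlgType")]
HB.structure Definition LieAlgebra (F : fieldType) :=
  { L of isLieAlgebra F L & Vector F L }.

Notation "[ 'lie' u , v ]" := (lie u v)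
  (at level 0, format "[ 'lie'  u ,  v ]") : ring_scope.

(* Subalgebras of L are represented as subspaces of L, and notions applying to
   a subalgebra S as a Lie algebra in its own right (its ideals, its maximal
   subalgebras, ...) are expressed relative to S inside L. *)
Section Definitions.
Variables (F : fieldType) (L : lieAlgType F).
Implicit Types (I J M N S U V W : {vspace L}).

Definition subalgebra S : Prop :=
  forall u v, u \in S -> v \in S -> [lie u, v] \in S.

(* One side suffices, since the bracket is antisymmetric. *)
Definition ideal_of S I : Prop :=
  (I <= S)%VS /\ (forall s u, s \in S -> u \in I -> [lie s, u] \in I).

Definition maximal_subalgebra_of S M : Prop :=
  [/\ subalgebra M, (M <= S)%VS, M <> S &
      forall N, subalgebra N -> (M <= N)%VS -> (N <= S)%VS -> N = M \/ N = S].

(* Membership in the intersection of the maximal subalgebras of S; when S has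
   none, i.e. when S = 0, this is S itself. *)
Definition in_frattini_subalgebra S (v : L) : Prop :=
  v \in S /\ (forall M, maximal_subalgebra_of S M -> v \in M).

(* I = phi(S): the largest ideal of S contained in its Frattini subalgebra.
   Existence and uniqueness of I are shown below. *)
Definition is_frattini_ideal S I : Prop :=
  [/\ ideal_of S I,
      forall v, v \in I -> in_frattini_subalgebra S v &
      forall J, ideal_of S J ->
        (forall v, v \in J -> in_frattini_subalgebra S v) -> (J <= I)%VS].

Definition elementary U : Prop :=
  forall S, subalgebra S -> (S <= U)%VS -> is_frattini_ideal S 0%VS.

Definition minimal_non_elementary : Prop :=
  ~ elementary fullv /\
  (forall U, subalgebra U -> U <> fullv -> elementary U).

(* The span of all brackets [u, v] with u in U and v in V; brackets of basis
   vectors suffice by bilinearity, see [lie_prodP]. *)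
Definition lie_prod U V : {vspace L} :=
  <<[seq [lie u, v] | u <- vbasis U, v <- vbasis V]>>%VS.

Fixpoint derived_series (n : nat) : {vspace L} :=
  if n is m.+1 then lie_prod (derived_series m) (derived_series m) else fullv.

Definition solvable_lie : Prop := exists n, derived_series n = 0%VS.

End Definitions.

Arguments minimal_non_elementary {F} L.
Arguments solvable_lie {F} L.

Section Sanity.
Variables (F : fieldType) (L : lieAlgType F).
Implicit Types (u v w : L) (I J M N S U V W : {vspace L}).

Lemma lieDl u v w : [lie u + v, w] = [lie u, w] + [lie v, w].
Proof. by have := lie_linearl 1 u v w; rewrite !scale1r. Qed.

Lemma lieDr u v w : [lie w, u + v] = [lie w, u] + [lie w, v].
Proof. by have := lie_linearr 1 u v w; rewrite !scale1r. Qed.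

Lemma lie0l w : [lie 0, w] = 0.
Proof. by apply: (@addrI _ [lie 0, w]); rewrite -lieDl !addr0. Qed.

Lemma lie0r w : [lie w, 0] = 0.
Proof. by apply: (@addrI _ [lie w, 0]); rewrite -lieDr !addr0. Qed.

Lemma lieZl a u w : [lie a *: u, w] = a *: [lie u, w].
Proof. by have := lie_linearl a u 0 w; rewrite lie0l !addr0. Qed.

Lemma lieZr a u w : [lie w, a *: u] = a *: [lie w, u].
Proof. by have := lie_linearr a u 0 w; rewrite lie0r !addr0. Qed.

Lemma lieC u v : [lie u, v] = - [lie v, u].
Proof.
apply/eqP; rewrite -addr_eq0; apply/eqP.
have := lie_alternating (u + v).
by rewrite lieDl !lieDr !lie_alternating add0r addr0.
Qed.

Lemma lie_suml (A : Type) (r : seq A) (P : pred A) (f : A -> L) w :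
  [lie \sum_(i <- r | P i) f i, w] = \sum_(i <- r | P i) [lie f i, w].
Proof.
exact: (big_morph (fun u => lie u w) (fun u v => lieDl u v w) (lie0l w)).
Qed.

Lemma lie_sumr (A : Type) (r : seq A) (P : pred A) (f : A -> L) w :
  [lie w, \sum_(i <- r | P i) f i] = \sum_(i <- r | P i) [lie w, f i].
Proof. exact: (big_morph (lie w) (fun u v => lieDr u v w) (lie0r w)). Qed.

Lemma lie_prodP U V W :
  reflect (forall u v, u \in U -> v \in V -> [lie u, v] \in W)
          (lie_prod U V <= W)%VS.
Proof.
apply: (iffP idP) => [sUVW u v uU vV | sW].
  rewrite (coord_vbasis uU) (coord_vbasis vV) lie_suml memv_suml // => i _.
  rewrite lie_sumr memv_suml // => j _.
  rewrite lieZl lieZr !memvZ // (subvP sUVW) // memv_span //.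
  by apply: allpairs_f; apply: mem_nth; rewrite size_tuple.
apply/span_subvP => _ /allpairsP[[u v] /= [uU vV ->]].
by apply: sW; apply: vbasis_mem.
Qed.

Lemma frattini_ideal_uniq S I J :
  is_frattini_ideal S I -> is_frattini_ideal S J -> I = J.
Proof.
move=> [idI fI maxI] [idJ fJ maxJ].
by apply/eqP; rewrite eqEsubv maxI // maxJ.
Qed.

Lemma frattini_ideal_exists S : exists I, is_frattini_ideal S I.
Proof.
pose good I := ideal_of S I /\ forall v, v \in I -> in_frattini_subalgebra S v.
have goodD I J : good I -> good J -> good (I + J)%VS.
  move=> [[sIS idI] fI] [[sJS idJ] fJ]; split.
    split=> [|s _ sS /memv_addP[u uI [v vJ ->]]]; first by rewrite subv_add sIS.
    by rewrite lieDr memv_add ?idI ?idJ.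
  move=> _ /memv_addP[u uI [v vJ ->]].
  have [[uS uM] [vS vM]] := (fI u uI, fJ v vJ).
  by split=> [|M maxM]; apply: rpredD => //; [apply: uM | apply: vM].
suff grow n I : good I -> (\dim {: L} - \dim I <= n)%N ->
    exists K, is_frattini_ideal S K.
  apply: (grow _ 0%VS _ (leqnn _)); split.
    split=> [|s u _]; first exact: sub0v.
    by rewrite memv0 => /eqP->; rewrite lie0r mem0v.
  move=> v; rewrite memv0 => /eqP->; split=> [|M _]; exact: mem0v.
elim: n I => [|n IHn] I gI dimI.
  exists I; case: (gI) => idI fI; split=> // J _ _.
  suff -> : I = fullv by apply: subvf.
  by apply/eqP; rewrite eqEdim subvf -subn_eq0 -leqn0.
have [[J [gJ nsJI]]|maxI] := classic (exists J, good J /\ ~~ (J <= I)%VS).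
  apply: (IHn _ (goodD _ _ gI gJ)); rewrite -ltnS; apply: leq_trans dimI.
  have ltI : (\dim I < \dim (I + J))%N.
    rewrite ltn_neqAle dimvS ?addvSl // andbT.
    apply: contra nsJI => /eqP eqd.
    have /eqP-> : I == (I + J)%VS by rewrite eqEdim addvSl -eqd leqnn.
    exact: addvSr.
  by rewrite ltn_sub2l // (leq_trans ltI) // dimvS ?subvf.
exists I; case: (gI) => idI fI; split=> // J idJ fJ.
by apply/negPn/negP => nsJI; apply: maxI; exists J.
Qed.

End Sanity.

(* Main.v *)
(* Call x, y, z a Jordan triple if [x, y] = alpha y + z, [x, z] = alpha z and
   [y, z] = 0. If z is nonzero, then the span S of the triple is 3-dimensional,
   and z lies in every maximal subalgebra of S, so S is not elementary. It
   remains to see that a solvable L in which every Jordan triple has z = 0 is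
   elementary. There every ad x acts diagonalizably on every abelian ideal,
   which forces L' to be abelian. A subalgebra S is then a sum H + A with
   H abelian and A = S cap L' spanned by common eigenvectors of S, and
   this produces, for each nonzero v in S, a subalgebra of codimension 1 in S
   that avoids v. *)

Require Import Defs.
From HB Require Import structures.
From mathcomp Require Import all_boot all_order all_algebra.
From Stdlib Require Import Classical.

Set Implicit Arguments.
Unset Strict Implicit.
Unset Printing Implicit Defensive.

Import GRing.Theory.
Local Open Scope ring_scope.

(** * Eigenvectors of semisimple operators on subspaces *)

Section LinearAlgebra.
Variables (F : fieldType) (V : vectType F).
Implicit Types (A U W : {vspace V}) (T : 'End(V)).

(** The second hypothesis makes the kernel of T on A meet T(A) only in 0, so by rank-nullity the
    dimensions add up to that of A. *)
Lemma ker_img_sum T A : (T @: A <= A)%VS ->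
    (forall a, a \in A -> T (T a) = 0 -> T a = 0) ->
  ((A :&: lker T) + T @: A)%VS = A.
Proof.
move=> TA ss; apply/eqP; rewrite eqEdim subv_add capvSl TA /=.
rewrite dimv_disjoint_sum ?limg_ker_dim //.
apply/eqP; rewrite -subv0; apply/subvP => w.
rewrite !memv_cap memv_ker memv0.
case/andP=> /andP[_ /eqP Tw0] /memv_imgP[u uA Ew].
by rewrite Ew (ss u uA) // -Ew.
Qed.

Lemma maximal_subspace (P : {vspace V} -> Prop) W0 : P W0 ->
  exists2 W, P W & forall U, P U -> (W <= U)%VS -> U = W.
Proof.
move: {2}(_ - _)%N (leqnn (\dim {:V} - \dim W0)) => n.
elim: n W0 => [|n IHn] W0 dimW PW0.
  exists W0 => // U _ sWU; apply/esym/eqP; rewrite eqEdim sWU.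
  by rewrite (leq_trans (dimvS (subvf U))) // -subn_eq0 -leqn0.
have [[U [PU sWU neUW]]|maxW] :=
    classic (exists U, [/\ P U, (W0 <= U)%VS & U <> W0]).
  apply: IHn PU; rewrite -ltnS; apply: leq_trans dimW.
  have lt_dim : (\dim W0 < \dim U)%N.
    by rewrite (ltn_leqif (dimv_leqif_eq sWU)); apply/eqP => E; apply: neUW.
  by rewrite ltn_sub2l // (leq_trans lt_dim) // dimvS ?subvf.
exists W0 => // U PU sWU; apply: NNPP => neUW.
by apply: maxW; exists U.
Qed.

Lemma memv_diff U W v : v \in (U :\: W)%VS -> v \in W -> v = 0.
Proof.
by move=> vU vW; apply/eqP; rewrite -memv0 -(capv_diff U W) memv_cap vU.
Qed.

End LinearAlgebra.

Lemma lfun_eigenvector (F : closedFieldType) (V : vectType F) (T : 'End(V))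
    (A : {vspace V}) : (T @: A <= A)%VS -> A != 0%VS ->
  exists mu a, [/\ a \in A, a != 0 & T a = mu *: a].
Proof.
move=> TA; rewrite -dimv_eq0 -lt0n => dimA.
(* Row i of M holds the coordinates of T on the i-th basis vector, so a row eigenvector of M lists
   the coordinates of an eigenvector of T. *)
pose M : 'M[F]_(\dim A) :=
  \matrix_(i, j) coord (vbasis A) j (T (vbasis A)`_i).
have /closed_rootP[mu] : size (char_poly M) != 1.
  by rewrite size_char_poly eqSS -lt0n.
rewrite -eigenvalue_root_char => /eigenvalueP[r rM r_neq0].
have TE (i : 'I_(\dim A)) : T (vbasis A)`_i = \sum_j M i j *: (vbasis A)`_j.
  rewrite {1}(@coord_vbasis _ _ (T (vbasis A)`_i) A); first last.
    by apply/(subvP TA)/memv_img/vbasis_mem/mem_nth; rewrite size_tuple.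
  by apply: eq_bigr => j _; rewrite mxE.
exists mu, (\sum_i r 0 i *: (vbasis A)`_i); split.
- apply: memv_suml => i _; apply/memvZ/vbasis_mem/mem_nth.
  by rewrite size_tuple.
- apply: contra r_neq0 => /eqP a0; apply/eqP/rowP => i; rewrite mxE.
  have /freeP-/(_ (fun i => r 0 i)) := basis_free (vbasisP A).
  exact.
rewrite linear_sum scaler_sumr.
transitivity (\sum_j (r *m M) 0 j *: (vbasis A)`_j).
  under [RHS]eq_bigr do rewrite mxE scaler_suml.
  rewrite exchange_big; apply: eq_bigr => i _ /=.
  rewrite linearZ /= TE scaler_sumr; apply: eq_bigr => j _.
  by rewrite scalerA.
by apply: eq_bigr => j _; rewrite rM mxE scalerA.
Qed.

(** The second hypothesis excludes Jordan blocks. For an eigenvalue mu and Q = T - mu, A is the sum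
    of the mu-eigenspace, which lies in U, and the T-stable Q(A), to which induction on the
    dimension applies. *)
Lemma semisimple_eigenvectors_span (F : closedFieldType) (V : vectType F)
    (T : 'End(V)) (A U : {vspace V}) :
    (T @: A <= A)%VS ->
    (forall mu a b, a \in A -> T a = mu *: a + b -> T b = mu *: b -> b = 0) ->
    (forall mu a, a \in A -> T a = mu *: a -> a \in U) ->
  (A <= U)%VS.
Proof.
move: {2}(\dim A) (leqnn (\dim A)) => n.
elim: n A => [|n IHn] A dimA TA ss eigU.
  by move: dimA; rewrite leqn0 dimv_eq0 => /eqP->; apply: sub0v.
have [->|A_neq0] := eqVneq A 0%VS; first exact: sub0v.
have [mu [a [aA a_neq0 Ta]]] := lfun_eigenvector TA A_neq0.
pose Q := (T - mu *: \1)%VF.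
have QE u : Q u = T u - mu *: u by rewrite /Q !lfun_simp.
have QA : (Q @: A <= A)%VS.
  apply/subvP => _ /memv_imgP[u uA ->].
  by rewrite QE memvB ?memvZ // (subvP TA) ?memv_img.
rewrite -(ker_img_sum QA); last first.
  move=> u uA QQu; apply: (ss mu u) => //; first by rewrite QE addrC subrK.
  by apply/eqP; rewrite -subr_eq0 -QE QQu.
rewrite subv_add; apply/andP; split.
  apply/subvP => u; rewrite memv_cap memv_ker QE subr_eq0 => /andP[uA /eqP].
  exact: eigU.
apply: IHn; last 3 first.
- apply/subvP => _ /memv_imgP[_ /memv_imgP[u uA ->] ->].
  suff -> : T (Q u) = Q (T u) by rewrite memv_img // (subvP TA) ?memv_img.
  by rewrite !QE linearB linearZ.
- by move=> nu u b uQ; apply: ss; apply: (subvP QA).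
- by move=> nu u uQ; apply: eigU; apply: (subvP QA).
(* Q(A) is smaller than A because Q kills the eigenvector a. *)
rewrite -ltnS; apply: leq_trans dimA.
rewrite -[X in (_ < X)%N](limg_ker_dim Q A) -[X in (X < _)%N]add0n ltn_add2r.
rewrite lt0n dimv_eq0; apply: contra a_neq0 => /eqP E.
by rewrite -memv0 -E memv_cap aA memv_ker QE Ta subrr eqxx.
Qed.

(** * Adjoint maps, derived series and criteria for a zero Frattini ideal *)

Section Lie.
Variables (F : fieldType) (L : lieAlgType F).
Implicit Types (u v w x y z : L) (A B H I M N S U W : {vspace L}).

Let lie_linear x : linear (lie x).
Proof. by move=> a u v; apply: lie_linearr. Qed.

HB.instance Definition _ x :=
  GRing.isLinear.Build F L L *:%R (lie x) (lie_linear x).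

Definition ad x : 'End(L) := linfun (lie x).

Lemma adE x y : ad x y = [lie x, y].
Proof. by rewrite lfunE. Qed.

Lemma lieBl x y z : [lie x - y, z] = [lie x, z] - [lie y, z].
Proof. by rewrite lieDl -scaleN1r lieZl scaleN1r. Qed.

Lemma lieBr x y z : [lie z, x - y] = [lie z, x] - [lie z, y].
Proof. exact: linearB. Qed.

Lemma lie_leibniz x y z :
  [lie x, [lie y, z]] = [lie [lie x, y], z] + [lie y, [lie x, z]].
Proof.
have /eqP := lie_jacobi x y z.
rewrite (lieC z x) linearN /= (lieC z) -addrA -opprD subr_eq0 => /eqP->.
exact: addrC.
Qed.

Lemma ad_img x A :
  (forall a, a \in A -> [lie x, a] \in A) -> (ad x @: A <= A)%VS.
Proof.
by move=> xA; apply/subvP => _ /memv_imgP[a aA ->]; rewrite adE xA.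
Qed.

Lemma derived_series_ideal n : @ideal_of F L fullv (derived_series L n).
Proof.
split=> [|x v _]; first exact: subvf.
elim: n x v => [|n IHn] x v; first by rewrite !memvf.
move=> vD; rewrite -adE memv_preim.
suff /subvP sD : (derived_series L n.+1 <= ad x @^-1: derived_series L n.+1)%VS.
  exact: sD.
apply/lie_prodP => u w uD wD; rewrite -memv_preim adE lie_leibniz.
have /lie_prodP D := subvv (derived_series L n.+1).
by rewrite memvD // D // IHn.
Qed.

Lemma derived_lie n u v :
  u \in derived_series L n -> v \in derived_series L n ->
  [lie u, v] \in derived_series L n.+1.
Proof. by have /lie_prodP D := subvv (derived_series L n.+1); apply: D. Qed.

(** Since B has codimension 1 in S, nothing lies strictly between them. So B is a maximal
    subalgebra, and v is outside the Frattini subalgebra. *)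
Lemma hyperplane_subalgebra_frattini S :
    (forall v, v \in S -> v != 0 ->
      exists B, [/\ subalgebra B, (B <= S)%VS, v \notin B
                  & (S <= B + <[v]>)%VS]) ->
  is_frattini_ideal S 0%VS.
Proof.
move=> hyp; split.
- split; first exact: sub0v.
  by move=> s u _; rewrite !memv0 => /eqP->; rewrite lie0r.
- move=> v; rewrite memv0 => /eqP->.
  by split=> [|M _]; rewrite mem0v.
move=> J idJ fJ; apply/subvP => v /fJ[vS frat_v]; rewrite memv0.
apply/negPn/negP => v_neq0; have [B [subB sBS vB sSB]] := hyp v vS v_neq0.
apply: (negP vB); apply: frat_v; split=> // [EB|M subM sBM sMS].
  by case/negP: vB; rewrite EB.
have [vM|vM] := boolP (v \in M); [right | left]; apply/eqP.
  rewrite eqEsubv sMS (subv_trans sSB) //.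
  by rewrite subv_add sBM; apply/subvP => _ /vlineP[k ->]; rewrite memvZ.
rewrite eqEsubv sBM andbT; apply/subvP => m mM.
have /memv_addP[b bB [_ /vlineP[k ->] Em]] := subvP sSB m (subvP sMS m mM).
have [k0|k_neq0] := eqVneq k 0; first by rewrite Em k0 scale0r addr0.
case/negP: vM; rewrite -(scalerK k_neq0 v) memvZ // -(addKr b (k *: v)) -Em.
by rewrite addrC memvB // (subvP sBM).
Qed.

(** A complement of the line of v in S has dimension at most 1, so it is a subalgebra. *)
Lemma dim_le2_frattini S : (\dim S <= 2)%N -> is_frattini_ideal S 0%VS.
Proof.
move=> dimS; apply: hyperplane_subalgebra_frattini => v vS v_neq0.
have sVS : (<[v]> <= S)%VS by apply/subvP => _ /vlineP[k ->]; rewrite memvZ.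
exists (S :\: <[v]>)%VS; split.
- have: (\dim (S :\: <[v]>) <= 1)%N.
    rewrite -(leq_add2l 1) addn1; apply: leq_trans dimS.
    by rewrite -(dimv_cap_compl S <[v]>) (capv_idPr sVS) dim_vline v_neq0.
  case: (eqVneq (S :\: <[v]>)%VS 0%VS) => [-> _ u w|B_neq0 dimB u w uB wB].
    by rewrite !memv0 => /eqP-> _; rewrite lie0l.
  pose b := vpick (S :\: <[v]>).
  have b_neq0 : b != 0 by rewrite vpick0.
  have EB : (S :\: <[v]>)%VS = <[b]>%VS.
    apply/esym/eqP; rewrite eqEdim dim_vline b_neq0 dimB andbT.
    by apply/subvP => _ /vlineP[k ->]; rewrite memvZ // memv_pick.
  move: uB wB; rewrite EB => /vlineP[k ->] /vlineP[l ->].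
  by rewrite lieZl lieZr lie_alternating !scaler0 mem0v.
- exact: diffvSl.
- by apply: contra v_neq0 => vB; apply/eqP/(memv_diff vB); apply: memv_line.
by rewrite addv_diff addvSl.
Qed.

(** * The span of a Jordan triple *)

Section JordanTriple.
Variables (alpha : F) (x y z : L).
Hypotheses (xy : [lie x, y] = alpha *: y + z) (xz : [lie x, z] = alpha *: z)
  (yz : [lie y, z] = 0).

Let S := <<[:: x; y; z]>>%VS.
Let xS : x \in S. Proof. by rewrite memv_span ?inE ?eqxx ?orbT. Qed.
Let yS : y \in S. Proof. by rewrite memv_span ?inE ?eqxx ?orbT. Qed.
Let zS : z \in S. Proof. by rewrite memv_span ?inE ?eqxx ?orbT. Qed.

Lemma jordan_triple_subalgebra : subalgebra S.
Proof.
suff gen u v : u \in [:: x; y; z] -> v \in [:: x; y; z] -> [lie u, v] \in S.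
  move=> u v uS vS; rewrite (coord_span uS) (coord_span vS) lie_suml.
  apply: memv_suml => i _; rewrite linear_sum /= memv_suml // => j _.
  by rewrite lieZl lieZr !memvZ // gen //; apply: mem_nth.
rewrite !inE => /or3P[]/eqP-> /or3P[]/eqP->; rewrite ?lie_alternating ?mem0v //.
- by rewrite xy memvD ?memvZ.
- by rewrite xz memvZ.
- by rewrite lieC xy memvN memvD ?memvZ.
- by rewrite yz mem0v.
- by rewrite lieC xz memvN memvZ.
- by rewrite lieC yz oppr0 mem0v.
Qed.

(* A maximal subalgebra M avoiding z satisfies M + Fz = S, hence contains
   x - dz and y - cz for some c, d; their bracket is alpha (y - cz) + z. *)
Lemma jordan_triple_frattini : is_frattini_ideal S 0%VS -> z = 0.
Proof.
have sZ u : u \in S -> [lie z, u] \in <[z]>%VS.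
  suff /subvP sSZ : (S <= ad z @^-1: <[z]>)%VS.
    by move=> uS; rewrite -adE memv_preim sSZ.
  apply/span_subvP => w; rewrite !inE -memv_preim adE.
  case/or3P=> /eqP->; last by rewrite lie_alternating mem0v.
    by rewrite lieC xz memvN memvZ ?memv_line.
  by rewrite lieC yz oppr0 mem0v.
have Zs u : u \in S -> [lie u, z] \in <[z]>%VS.
  by move=> uS; rewrite lieC memvN sZ.
move=> [_ _ maxI]; apply/eqP; rewrite -memv0.
have ZJ : (<[z]> <= 0)%VS -> z \in 0%VS.
  by move/subvP; apply; apply: memv_line.
apply/ZJ/maxI => [|_ /vlineP[k ->]].
  split=> [|s _ sS /vlineP[k ->]]; last by rewrite linearZ memvZ //= Zs.
  by apply/subvP => _ /vlineP[k ->]; rewrite memvZ.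
split=> [|M [subM sMS _ maxM]]; first by rewrite memvZ.
apply: memvZ.
have zMZ : z \in (M + <[z]>)%VS by rewrite (subvP (addvSr _ _)) ?memv_line.
have subMZ : subalgebra (M + <[z]>)%VS.
  move=> u0 w0 /memv_addP[u uM [_ /vlineP[c ->] ->]].
  move=> /memv_addP[w wM [_ /vlineP[d ->] ->]].
  have -> : [lie u + c *: z, w + d *: z] =
            [lie u, w] + (d *: [lie u, z] + c *: [lie z, w]).
    rewrite lieDl !lieDr !lieZl !lieZr lie_alternating !scaler0 addr0.
    by rewrite addrA.
  by rewrite memv_add ?subM // memvD ?memvZ ?sZ ?Zs // (subvP sMS).
have sMZS : (M + <[z]> <= S)%VS.
  by rewrite subv_add sMS; apply/subvP => _ /vlineP[c ->]; rewrite memvZ.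
have [EM|ES] := maxM _ subMZ (addvSl _ _) sMZS; first by rewrite -EM.
move: xS yS; rewrite -ES => /memv_addP[n nM [_ /vlineP[d ->] Ex]].
move=> /memv_addP[m mM [_ /vlineP[c ->] Ey]].
have Em : m = y - c *: z by rewrite Ey addrK.
have En : n = x - d *: z by rewrite Ex addrK.
have nm : [lie n, m] = alpha *: m + z.
  rewrite En lieBl lieZl Em !lieBr !lieZr xy xz (lieC z y) yz.
  rewrite lie_alternating !(scaler0, oppr0, subr0) scalerBr addrAC.
  by rewrite !scalerA mulrC.
by rewrite -(addKr (alpha *: m) z) -nm memvD ?memvN ?memvZ // subM.
Qed.

(** Independence comes from the brackets: y = kz would give [x, y] = alpha y, and x = ky + lz would
    give [x, y] = [x, z] = 0. Either forces z = 0. *)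
Lemma jordan_triple_basis : z != 0 -> S = fullv -> basis_of fullv [:: x; y; z].
Proof.
move=> z_neq0 ES; apply/andP; split; first exact/eqP.
have y_notin : y \notin <[z]>%VS.
  apply/negP => /vlineP[k Ey]; case/eqP: z_neq0.
  by move: xy; rewrite Ey linearZ /= xz !scalerA mulrC -[LHS]addr0 => /addrI.
have x_notin : x \notin <<[:: y; z]>>%VS.
  apply/negP; rewrite span_cons span_seq1 => /memv_addP[_ /vlineP[k ->]].
  move=> [_ /vlineP[l ->] Ex]; case/eqP: z_neq0.
  have xz0 : [lie x, z] = 0.
    by rewrite Ex lieDl !lieZl yz lie_alternating !scaler0 addr0.
  have /eqP : [lie x, y] = 0.
    rewrite Ex lieDl !lieZl (lieC z y) yz lie_alternating oppr0.
    by rewrite !scaler0 addr0.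
  move: xz0; rewrite xz xy => /eqP; rewrite scaler_eq0 => /orP[/eqP->|/eqP->//].
  by rewrite scale0r add0r => /eqP.
by rewrite !free_cons x_notin span_seq1 y_notin span_nil memv0 z_neq0 nil_free.
Qed.

End JordanTriple.

End Lie.

(** * Algebras in which every Jordan triple has z = 0 *)

Section NoJordanTriple.
Variables (F : closedFieldType) (L : lieAlgType F).
Implicit Types (u v w x y z : L) (A B H I M N S U W : {vspace L}).

Hypothesis no_triple : forall (alpha : F) x y z,
  [lie x, y] = alpha *: y + z -> [lie x, z] = alpha *: z -> [lie y, z] = 0 ->
  z = 0.

(* For an eigenvector a of ad d with eigenvalue mu, put b = [e, a]; then
   [[d, e], a] = [d, b] - mu b is a mu-eigenvector of ad d, so that d, b,
   [[d, e], a] is a Jordan triple. *)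
Lemma commuting_bracket_trivial A d e :
    (forall a b, a \in A -> b \in A -> [lie a, b] = 0) ->
    (forall a, a \in A -> [lie d, a] \in A) ->
    (forall a, a \in A -> [lie e, a] \in A) ->
    (forall a, a \in A -> [lie [lie d, [lie d, e]], a] = 0) ->
  forall a, a \in A -> [lie [lie d, e], a] = 0.
Proof.
move=> abA dA eA df; set f := [lie d, e].
suff /subvP sA : (A <= lker (ad f))%VS.
  by move=> a /sA; rewrite memv_ker adE => /eqP.
apply: (@semisimple_eigenvectors_span _ _ (ad d)) => [|mu a b aA|mu a aA].
- exact: ad_img.
- rewrite !adE => da db; apply: (no_triple da db); apply: abA => //.
  have -> : b = [lie d, a] - mu *: a by rewrite da addrC addKr.
  by rewrite memvB ?memvZ ?dA.
rewrite memv_ker !adE => da; apply/eqP.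
have Ec : [lie d, [lie e, a]] = mu *: [lie e, a] + [lie f, a].
  by rewrite lie_leibniz da lieZr addrC.
have cA : [lie f, a] \in A.
  have -> : [lie f, a] = [lie d, [lie e, a]] - mu *: [lie e, a].
    by rewrite Ec addrC addKr.
  by rewrite memvB ?memvZ ?dA ?eA.
apply: (no_triple Ec); last by apply: abA => //; apply: eA.
by rewrite lie_leibniz df // add0r da lieZr.
Qed.

(* Write A = L^(n+2), P = L^(n+1), M = L^(n). Applying
   commuting_bracket_trivial first with d in P and then with d in M shows that
   [P, M], and then P, centralizes A; hence P is nilpotent of class 2, so
   abelian for want of a triple with eigenvalue 0. *)
Lemma derived_series_step n :
  derived_series L n.+3 = 0%VS -> derived_series L n.+2 = 0%VS.
Proof.
move=> D0.
have idD k x u : u \in derived_series L k -> [lie x, u] \in derived_series L k.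
  by have [_ id] := derived_series_ideal L k; apply: id; rewrite memvf.
have abA a b : a \in derived_series L n.+2 ->
    b \in derived_series L n.+2 -> [lie a, b] = 0.
  by move=> aA bA; apply/eqP; rewrite -memv0 -D0 derived_lie.
have PM d e : d \in derived_series L n.+1 -> e \in derived_series L n ->
    forall a, a \in derived_series L n.+2 -> [lie [lie d, e], a] = 0.
  move=> dP eM.
  apply: commuting_bracket_trivial => // [a|a|a aA]; try exact: idD.
  by apply: abA => //; apply: derived_lie => //; rewrite lieC memvN; apply: idD.
have cP d a : d \in derived_series L n.+1 ->
    a \in derived_series L n.+2 -> [lie d, a] = 0.
  move=> dP aA; suff /subvP sP : (derived_series L n.+1 <= lker (ad a))%VS.
    by have := sP d dP; rewrite memv_ker adE lieC oppr_eq0 => /eqP.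
  apply/lie_prodP => u v uM vM; rewrite memv_ker adE lieC oppr_eq0.
  apply/eqP/(@commuting_bracket_trivial (derived_series L n.+2)) => // b bA;
    try exact: idD.
  by rewrite (lieC u) -scaleN1r lieZl PM ?scaler0 ?derived_lie.
pose P := derived_series L n.+1.
apply/eqP; rewrite -subv0; apply/(@lie_prodP _ _ P P) => x y xP yP.
rewrite memv0; apply/eqP; have zA := derived_lie xP yP.
apply: (@no_triple 0 x y); rewrite ?scale0r ?add0r //; exact: cP.
Qed.

Lemma solvable_metabelian : solvable_lie L -> derived_series L 2 = 0%VS.
Proof.
have desc n : (derived_series L n.+1 <= derived_series L n)%VS.
  apply/lie_prodP => u v _; have [_ id] := derived_series_ideal L n.
  by apply: id; rewrite memvf.
(* The index is raised by 2 so that descending with [derived_series_step] ends at 2 for every n. *)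
case=> n Dn0; have {Dn0}: derived_series L n.+2 = 0%VS.
  by apply/eqP; rewrite -subv0 -Dn0 (subv_trans (desc _)).
by elim: n => // n IHn /derived_series_step.
Qed.

(** * Subalgebras when an abelian N contains all brackets *)

Section Metabelian.
Variable N : {vspace L}.
Hypotheses (LN : forall x y, [lie x, y] \in N)
  (abN : forall a b, a \in N -> b \in N -> [lie a, b] = 0).

Lemma ad_semisimple mu x a b :
  a \in N -> [lie x, a] = mu *: a + b -> [lie x, b] = mu *: b -> b = 0.
Proof.
move=> aN xa xb; apply: (no_triple xa xb); apply: abN => //.
have -> : b = [lie x, a] - mu *: a by rewrite xa addrC addKr.
by rewrite memvB ?memvZ ?LN.
Qed.

Lemma ad_commute x y a : a \in N -> [lie x, [lie y, a]] = [lie y, [lie x, a]].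
Proof. by move=> aN; rewrite lie_leibniz abN ?add0r. Qed.

(** Induction on the dimension of S. If S centralizes S cap N, then u, v, [u, v] is a triple with
    eigenvalue 0, so S is abelian. Otherwise some x in S acts nontrivially on S cap N, and S is
    replaced by the Fitting null component of ad x. *)
Lemma abelian_supplement S : subalgebra S ->
  exists H, [/\ (H <= S)%VS, forall u v, u \in H -> v \in H -> [lie u, v] = 0
              & (S <= H + S :&: N)%VS].
Proof.
move: {2}(\dim S) (leqnn (\dim S)) => n.
elim: n S => [|n IHn] S dimS subS.
  move: dimS; rewrite leqn0 dimv_eq0 => /eqP->; exists 0%VS; split.
  - exact: sub0v.
  - by move=> u v; rewrite memv0 => /eqP-> _; rewrite lie0l.
  exact: sub0v.
pose A := (S :&: N)%VS.
have [cA|] := classic (forall x a, x \in S -> a \in A -> [lie x, a] = 0).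
  exists S; split=> // [u v uS vS|]; last exact: addvSl.
  have zA : [lie u, v] \in A by rewrite memv_cap subS // LN.
  by apply: (@no_triple 0 u v); rewrite ?scale0r ?add0r //; apply: cA.
move=> /not_all_ex_not[x] /not_all_ex_not[a] ncA.
have [xS [aA xa]] : x \in S /\ a \in A /\ [lie x, a] <> 0 by tauto.
have ss b : b \in A -> [lie x, [lie x, b]] = 0 -> [lie x, b] = 0.
  rewrite memv_cap => /andP[_ bN] xxb.
  by apply: (@ad_semisimple 0 x b) => //; rewrite scale0r ?add0r.
have AA : (ad x @: A <= A)%VS.
  apply: ad_img => b; rewrite !memv_cap LN => /andP[bS _].
  by rewrite subS.
pose T := (S :&: lker (ad x \o ad x)%VF)%VS.
have memT s : (s \in T) = (s \in S) && ([lie x, [lie x, s]] == 0).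
  by rewrite memv_cap memv_ker lfunE /= !adE.
(* In the Leibniz expansion of (ad x)^2 [s, t] the mixed terms [[x, s], [x, t]] vanish because N is
   abelian. *)
have subT : subalgebra T.
  move=> s t; rewrite !memT => /andP[sS /eqP xxs] /andP[tS /eqP xxt].
  rewrite subS //= (lie_leibniz x s) lieDr (lie_leibniz x [lie x, s]).
  rewrite (lie_leibniz x s [lie x, t]) xxs xxt lie0l.
  by rewrite !(@abN _ [lie x, _]) ?LN // lie0r !addr0.
have dimT : (\dim T <= n)%N.
  rewrite -ltnS; apply: leq_trans dimS; have sTS : (T <= S)%VS := capvSl _ _.
  rewrite (ltn_leqif (dimv_leqif_eq sTS)); apply/eqP => ET.
  have : a \in T by rewrite ET (subvP (capvSl _ _ : A <= S)%VS).
  by rewrite memT => /andP[_ /eqP/(ss a aA)].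
have sST : (S <= T + A)%VS.
  have sumA : (A :&: lker (ad x) + ad x @: A)%VS = A.
    by apply: ker_img_sum AA _ => b; rewrite !adE; apply: ss.
  (* Write [x, s] = k + [x, b] with k, b in A and [x, k] = 0; then ad x maps s - b to k, so s - b is
     in T. *)
  apply/subvP => s sS; have : [lie x, s] \in A by rewrite memv_cap subS // LN.
  rewrite -{1}sumA => /memv_addP[k].
  rewrite memv_cap memv_ker adE => /andP[_ /eqP xk].
  move=> [_ /memv_imgP[b bA ->]]; rewrite adE => xs.
  rewrite -(subrK b s); apply: memv_add => //; rewrite memT.
  have bS : b \in S by move: bA; rewrite memv_cap => /andP[].
  by rewrite memvB //= lieBr xs addrK xk.
have [H [sHT abH sTH]] := IHn T dimT subT.
exists H; split=> //; first exact: subv_trans sHT (capvSl _ _).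
apply: subv_trans sST _; rewrite subv_add addvSr andbT.
by rewrite (subv_trans sTH) // addvS // capvS // capvSl.
Qed.

(** Simultaneous diagonalization by induction on the dimension of A. If some x in S is not scalar on
    A, its eigenspaces in A are proper, and they are S-stable because adjoint maps commute on N. *)
Lemma common_eigenvectors_span S A U :
    (A <= N)%VS -> (forall x a, x \in S -> a \in A -> [lie x, a] \in A) ->
    (forall a, a \in A ->
      (forall x, x \in S -> exists mu, [lie x, a] = mu *: a) -> a \in U) ->
  (A <= U)%VS.
Proof.
move: {2}(\dim A) (leqnn (\dim A)) => n.
elim: n A => [|n IHn] A dimA sAN SA eigU.
  by move: dimA; rewrite leqn0 dimv_eq0 => /eqP->; apply: sub0v.
have [sc|] := classic (forall x, x \in S ->
    exists mu, forall a, a \in A -> [lie x, a] = mu *: a).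
  apply/subvP => a aA; apply: eigU => // x xS.
  by have [mu xA] := sc x xS; exists mu; apply: xA.
move=> /not_all_ex_not[x] nsc.
have [xS xA] :
    x \in S /\ ~ exists mu, forall a, a \in A -> [lie x, a] = mu *: a.
  by tauto.
apply: (@semisimple_eigenvectors_span _ _ (ad x)).
- by apply: ad_img => a; apply: SA.
- by move=> mu a b /(subvP sAN) aN; rewrite !adE; apply: ad_semisimple.
move=> mu a aA; rewrite adE => xa.
pose E := (A :&: lker (ad x - mu *: \1%VF))%VS.
have memE b : (b \in E) = (b \in A) && ([lie x, b] == mu *: b).
  by rewrite memv_cap memv_ker !lfun_simp subr_eq0.
suff /subvP : (E <= U)%VS by apply; rewrite memE aA xa eqxx.
have sEA : (E <= A)%VS := capvSl _ _.
apply: IHn.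
- rewrite -ltnS; apply: leq_trans dimA.
  rewrite (ltn_leqif (dimv_leqif_eq sEA)); apply/eqP => EE; apply: xA.
  by exists mu => b; rewrite -EE memE => /andP[_ /eqP].
- exact: subv_trans sAN.
- move=> y b yS; rewrite !memE => /andP[bA /eqP xb].
  by rewrite SA //= ad_commute ?xb ?lieZr // (subvP sAN).
by move=> b /(subvP sEA); apply: eigU.
Qed.

(** Take W maximal among the S-stable subspaces of A avoiding v. For a common eigenvector a, W + Fa
    is stable, so either it equals W or it contains v; in both cases a is in W + Fv, and such a span
    A. *)
Lemma stable_hyperplane S A v :
    (A <= N)%VS -> (forall x a, x \in S -> a \in A -> [lie x, a] \in A) ->
    v != 0 ->
  exists W, [/\ (W <= A)%VS, forall x a, x \in S -> a \in W -> [lie x, a] \in W,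
                v \notin W & (A <= W + <[v]>)%VS].
Proof.
move=> sAN SA v_neq0.
have [|W [sWA SW vW] maxW] := @maximal_subspace _ _ (fun W => [/\ (W <= A)%VS,
    forall x a, x \in S -> a \in W -> [lie x, a] \in W & v \notin W]) 0%VS.
  split; rewrite ?sub0v ?memv0 // => x a _.
  by rewrite !memv0 => /eqP->; rewrite lie0r.
exists W; split=> //.
apply: (common_eigenvectors_span sAN SA) => a aA eig_a.
have [vWa|vWa] := boolP (v \in W + <[a]>)%VS.
  have [w wW [_ /vlineP[k ->] Ev]] := memv_addP vWa.
  have k_neq0 : k != 0.
    by apply: contra vW => /eqP k0; rewrite Ev k0 scale0r addr0.
  rewrite -(scalerK k_neq0 a) memvZ // -(addKr w (k *: a)) -Ev.
  by rewrite memv_add ?memvN ?memv_line.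
have <- : (W + <[a]>)%VS = W; last first.
  by rewrite (subvP (addvSl _ _)) // (subvP (addvSr _ _)) ?memv_line.
apply: maxW; last exact: addvSl.
split=> // [|x _ xS /memv_addP[w wW [_ /vlineP[k ->] ->]]].
  by rewrite subv_add sWA; apply/subvP => _ /vlineP[k ->]; rewrite memvZ.
have [mu xa] := eig_a x xS.
by rewrite lieDr lieZr xa memv_add ?SW // !memvZ ?memv_line.
Qed.

Lemma metabelian_frattini S : subalgebra S -> is_frattini_ideal S 0%VS.
Proof.
move=> subS; apply: hyperplane_subalgebra_frattini => v vS v_neq0.
pose A := (S :&: N)%VS.
have sAS : (A <= S)%VS := capvSl _ _.
have sAN : (A <= N)%VS := capvSr _ _.
have LA x y : x \in S -> y \in S -> [lie x, y] \in A.
  by move=> xS yS; rewrite memv_cap subS // LN.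
have sVS : (<[v]> <= S)%VS by apply/subvP => _ /vlineP[k ->]; rewrite memvZ.
have [vA|vA] := boolP (v \in A); last first.
  (* All brackets of S lie in A, so any subspace of S containing A is a subalgebra. *)
  pose K := (A + <[v]>)%VS; exists (A + (S :\: K))%VS.
  have sBS : (A + (S :\: K) <= S)%VS by rewrite subv_add sAS diffvSl.
  split=> //.
  - move=> x y /(subvP sBS) xS /(subvP sBS) yS.
    by rewrite (subvP (addvSl _ _)) // LA.
  - apply: contra vA => /memv_addP[a aA [c cSK Ev]].
    suff c0 : c = 0 by rewrite Ev c0 addr0.
    apply: (memv_diff cSK); have -> : c = - a + v by rewrite Ev addKr.
    by rewrite memv_add ?memvN ?memv_line.
  by rewrite (addvC A) -addvA -/K addv_diff addvSl.
have [H0 [sHS abH sSH]] := abelian_supplement subS.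
have [|||W [sWA SW vW sAW]] := @stable_hyperplane S A v => //.
  by move=> x a xS /(subvP sAS); apply: LA.
(* H0 may meet A; its part H complementary to H0 cap A meets A only in 0, so if v in A were in H +
   W, it would be in W. *)
pose H := (H0 :\: A)%VS; have sHH0 : (H <= H0)%VS := diffvSl _ _.
have sBS : (H + W <= S)%VS.
  by rewrite subv_add (subv_trans sHH0) // (subv_trans sWA).
exists (H + W)%VS; split=> //.
- move=> _ _ /memv_addP[h hH [w wW ->]] /memv_addP[h' hH' [w' wW' ->]].
  have hS u : u \in H -> u \in S by move/(subvP sHH0)/(subvP sHS).
  rewrite lieDl !lieDr abH ?(subvP sHH0) // add0r.
  rewrite (abN (subvP sAN _ (subvP sWA _ wW)) (subvP sAN _ (subvP sWA _ wW'))).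
  rewrite addr0; apply/(subvP (addvSr H W))/memvD; first by rewrite SW ?hS.
  by rewrite lieC memvN SW ?hS.
- apply: contra vW => /memv_addP[h hH [w wW Ev]].
  suff h0 : h = 0 by rewrite Ev h0 add0r.
  apply: (memv_diff hH); have -> : h = v - w by rewrite Ev addrK.
  by rewrite memvB // (subvP sWA).
rewrite -addvA; apply: (subv_trans sSH); rewrite subv_add -/A.
rewrite (subv_trans sAW) ?addvSr // andbT.
rewrite -{1}(addv_diff_cap H0 A) addvS //.
by rewrite (subv_trans (capvSr _ _)).
Qed.

End Metabelian.
End NoJordanTriple.

Theorem theorem2p2 (F : closedFieldType) (L : lieAlgType F)
    (solL : solvable_lie L) :
  minimal_non_elementary L <->
  exists (alpha : F) (x y z : L),
    [/\ basis_of fullv [:: x; y; z],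
        [lie x, y] = alpha *: y + z,
        [lie x, z] = alpha *: z &
        [lie y, z] = 0].
Proof.
split=> [[nel min]|[alpha [x [y [z [xyz_basis xy xz yz]]]]]].
  apply: NNPP => no_basis; apply: nel => S subS _.
  have no_triple (alpha : F) (x y z : L) : [lie x, y] = alpha *: y + z ->
      [lie x, z] = alpha *: z -> [lie y, z] = 0 -> z = 0.
    (* With z nonzero the span of the triple is not elementary, so by minimality it is all of L and
       the triple is an excluded basis. *)
    move=> xy xz yz; apply/eqP/negPn/negP => z_neq0.
    have subT := jordan_triple_subalgebra xy xz yz.
    apply: no_basis; exists alpha, x, y, z; split=> //.
    apply: (jordan_triple_basis xy xz yz z_neq0); apply: NNPP => neT.
    case/eqP: z_neq0; apply: (jordan_triple_frattini xy xz yz).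
    exact: (min _ subT neT _ subT).
  pose N := derived_series L 1.
  apply: (@metabelian_frattini _ _ no_triple N) => // [x y|a b aN bN].
    by apply: derived_lie; apply: memvf.
  apply/eqP; rewrite -memv0 -(solvable_metabelian no_triple solL).
  exact: derived_lie.
have z_neq0 : z != 0.
  apply: (free_not0 (basis_free xyz_basis)).
  by rewrite !inE eqxx !orbT.
have dimL : \dim {:L} = 3 by have := size_basis xyz_basis.
split=> [el|U subU neU S subS sSU].
  case/eqP: z_neq0; apply: (jordan_triple_frattini xy xz yz).
  by apply: el (subvf _); apply: (jordan_triple_subalgebra xy xz yz).
apply: dim_le2_frattini; apply: leq_trans (dimvS sSU) _.
suff: (\dim U < \dim {:L})%N by rewrite dimL.
by rewrite (ltn_leqif (dimv_leqif_eq (subvf U))); apply/eqP.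
Qed.
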